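(* Let $k\ge1$, let $Q\in\mathbb{R}^{d\times d}$ be skew-symmetric, $M\in\mathbb{R}^{d\times d}$ symmetric, $A=QM$, $T>0$, and let $U:\mathbb{R}^d\to\mathbb{R}$ be a polynomial of degree $k+2$. Consider the $k$-step EKahan scheme $$x_{n+k}=e^{khA}x_n+kh\,\phi(khA)\,Q\,\nabla_{\mathrm K}U(x_n,x_{n+1},\ldots,x_{n+k}),$$ and write $\nabla_{\mathrm K}U(x_n,\ldots,x_{n+k})=B_nx_{n+k}+\ell_n$, with $B_n\in\mathbb{R}^{d\times d}$ and $\ell_n\in\mathbb{R}^d$ depending only on $(x_n,\ldots,x_{n+k-1})$. Let $\mathcal K\subset(\mathbb{R}^d)^k$ be a bounded set of histories such that on $\mathcal K$ one has $\|B_n\|\le M_B$ and the mappings $(x_n,\ldots,x_{n+k-1})\mapsto B_n$ and $(x_n,\ldots,x_{n+k-1})\mapsto\ell_n$ are Lipschitz. Then there exist $h_0>0$ and $C>0$, independent of $h$ and $n$, such that for every $0<h\le h_0$: (i) the scheme is well-defined: for every history $(x_n,\ldots,x_{n+k-1})\in\mathcal K$ there is exactly one $x_{n+k}\in\mathbb{R}^d$ satisfying the scheme; (ii) the scheme is stable on $[0,T]$ with respect to perturbations of the starting values: if $(x_n)$ and $(\tilde x_n)$ are two numerical solutions of the scheme with the same step size $h$ whose histories remain in $\mathcal K$, and $Y_n=(x_{n+k-1},\ldots,x_n)$, $\tilde Y_n=(\tilde x_{n+k-1},\ldots,\tilde x_n)$, then $$\|Y_n-\tilde Y_n\|_\infty\le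 C\,\|Y_0-\tilde Y_0\|_\infty,\qquad 0\le nh\le T.$$
   Context: $\|\cdot\|$ denotes a vector norm on $\mathbb{R}^d$ and the induced matrix norm; for a $k$-tuple, $\|(x_{n+k-1},\ldots,x_n)\|_\infty=\max_{0\le j\le k-1}\|x_{n+j}\|$. $\phi(z)=\frac{e^z-1}{z}$ (entire, $\phi(0)=1$), applied to matrices through its power series. The bound $M_\phi=\max_{0\le s\le kT}\|\phi(sA)\|$ is finite. Polarized gradient $\nabla_{\mathrm K}U$: if $U$ is homogeneous of degree $k+2$, $$\nabla_{\mathrm K}U(x_n,\ldots,x_{n+k})=\sum_{\substack{1\le m\le k+1\\ n\le i_1<\cdots<i_m\le n+k}}\frac{(-1)^{k+1-m}}{(k+1)!}\,\nabla U(x_{i_1}+\cdots+x_{i_m}),$$ the symmetric $(k+1)$-linear polarization of $\nabla U$. If $U$ is a nonhomogeneous polynomial of degree $k+2$, let $\bar U(s,x)$ be the homogeneous polynomial of degree $k+2$ in $(s,x)\in\mathbb{R}\times\mathbb{R}^d$ with $\bar U(1,x)=U(x)$; then $\nabla_{\mathrm K}U(x_n,\ldots,x_{n+k})$ is the $x$-component of the polarization of $\nabla\bar U$ at $(1,x_n),\ldots,(1,x_{n+k})$, i.e. the same sum with $\nabla U(x_{i_1}+\cdots+x_{i_m})$ replaced by $\nabla_x\bar U(m,x_{i_1}+\cdots+x_{i_m})$. In all cases $\nabla_{\mathrm K}U$ is affine in its last argument, which defines $B_n$ and $\ell_n$. *)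

(* Defs.v *)
From HB Require Import structures.
From mathcomp Require Import all_boot all_order all_algebra.
From mathcomp Require mpoly.
Set Implicit Arguments.
Unset Strict Implicit.
Unset Printing Implicit Defensive.
Import Order.TTheory GRing.Theory Num.Theory.
Local Open Scope ring_scope.

Definition snoc {V : Type} {m : nat} (X : 'I_m -> V) (y : V) : 'I_m.+1 -> V :=
  fun i => if unlift ord_max i is Some j then X j else y.

Lemma snoc_max (V : Type) m (X : 'I_m -> V) y : snoc X y ord_max = y.
Proof. by rewrite /snoc unlift_none. Qed.

Lemma snoc_lift (V : Type) m (X : 'I_m -> V) y i :
  snoc X y (lift ord_max i) = X i.
Proof. by rewrite /snoc liftK. Qed.

Section Polarization.
Context {R : fieldType}.

Lemma sum_supset_sign n (A : {set 'I_n}) :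
  \sum_(S : {set 'I_n} | A \subset S) (-1) ^+ (n - #|S|) = (A == setT)%:R :> R.
Proof.
have [->|nA] := eqVneq A setT.
  rewrite (big_pred1 setT) ?cardsT ?card_ord ?subnn // => S.
  by rewrite subTset.
have /subsetPn[a _ aA] : ~~ (setT \subset A) by rewrite subTset.
rewrite (bigID (fun S : {set 'I_n} => a \in S)) /=.
rewrite (reindex_onto (fun S => a |: S) (fun S => S :\ a)) /=; last first.
  by move=> S /andP[_ aS]; rewrite setD1K.
rewrite (eq_bigl (fun S : {set 'I_n} => (A \subset S) && (a \notin S))); last first.
  move=> S; rewrite setU11 andbT; apply/andP/andP => -[h1 h2].
    have aS : a \notin S by rewrite -(eqP h2) !inE eqxx.
    split=> //; apply/subsetP => x xA; have := subsetP h1 x xA.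
    by rewrite !inE => /orP[/eqP e|//]; move: xA; rewrite e (negPf aA).
  by split; [exact: subset_trans h1 (subsetUr _ _)|rewrite setU1K].
rewrite -big_split big1 //= => S /andP[_ aS].
have := max_card (mem (a |: S)); rewrite card_ord cardsU1 aS /= => hS.
by rewrite add1n -(subnSK hS) exprS mulN1r addrN.
Qed.

Lemma polarization n (u : 'I_n.+1 -> 'I_n.+1 -> R) :
  \sum_(S : {set 'I_n.+1} | (0 < #|S|)%N)
    (-1) ^+ (n.+1 - #|S|) * \prod_t \sum_(i in S) u t i =
  \sum_(f : {ffun 'I_n.+1 -> 'I_n.+1} | injectiveb f) \prod_t u t (f t).
Proof.
transitivity (\sum_(S : {set 'I_n.+1})
    (-1) ^+ (n.+1 - #|S|) * \prod_t \sum_(i in S) u t i).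
  rewrite [RHS](bigID (fun S : {set 'I_n.+1} => (0 < #|S|)%N)) /=.
  rewrite [X in _ = _ + X]big1 ?addr0 // => S; rewrite -leqNgt leqn0 cards_eq0.
  by move=> /eqP ->; rewrite big_ord_recl big_set0 mul0r mulr0.
under eq_bigr => S _.
  rewrite (bigA_distr_big (mem S)) /= big_distrr /=.
  over.
rewrite (exchange_big_dep predT) //= [RHS]big_mkcond /=.
apply: eq_bigr => f _; rewrite -big_distrl /=.
rewrite (eq_bigl (fun S : {set 'I_n.+1} => [set f x | x in setT] \subset S)).
  rewrite sum_supset_sign; case: ifPn => [/injectiveP fi|fi].
    suff -> : [set f x | x in setT] = setT by rewrite eqxx mul1r.
    apply/eqP; rewrite eqEcard subsetT card_imset //=.
  case: (_ =P _) => [e|_]; last by rewrite mul0r.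
  case/negP: fi; apply/injectiveP.
  have /imset_injP h : #|[set f x | x in setT]| == #|[set: 'I_n.+1]| by rewrite e.
  by move=> x y /h; apply; rewrite inE.
move=> S; apply/ffun_onP/subsetP => [h _ /imsetP[x _ ->]//|h x].
by apply/h/imsetP; exists x.
Qed.

Definition affine d (F : 'cV[R]_d -> R) :=
  forall y, F y = \sum_j (F (delta_mx j 0) - F 0) * y j 0 + F 0.

Lemma affine_sum d (I : Type) (r : seq I) (P : pred I)
    (F : I -> 'cV[R]_d -> R) : (forall i, P i -> affine (F i)) ->
  affine (fun y => \sum_(i <- r | P i) F i y).
Proof.
move=> hF y; under [X in _ = X + _]eq_bigr => j _ do
  rewrite -sumrB big_distrl /=.
rewrite exchange_big -big_split /=; apply: eq_bigr => i /hF; exact.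
Qed.

Lemma affine_mull d (c : R) (F : 'cV[R]_d -> R) :
  affine F -> affine (fun y => c * F y).
Proof.
move=> hF y; rewrite {1}hF mulrDr mulr_sumr; congr (_ + _).
by apply: eq_bigr => j _; rewrite mulrA mulrBr.
Qed.

Lemma affine_cst d (c : R) : affine (fun _ : 'cV[R]_d => c).
Proof. by move=> y; rewrite big1 ?add0r // => j _; rewrite subrr mul0r. Qed.

Lemma affine_coord d i : affine (fun y : 'cV[R]_d => y i 0).
Proof.
move=> y; rewrite (bigD1 i) //= big1 => [|j ji]; rewrite !mxE ?eqxx.
  by rewrite subr0 mul1r !addr0.
by rewrite [i == j]eq_sym (negPf ji) /= subrr mul0r.
Qed.

Lemma affine_eq d (F G : 'cV[R]_d -> R) : F =1 G -> affine G -> affine F.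
Proof.
by move=> e hG y; rewrite !e hG; congr (_ + _); apply: eq_bigr => j _; rewrite !e.
Qed.

End Polarization.

Section PolarizedGradient.
Import mpoly.
Context {R : fieldType} {d : nat}.

Definition hpoint (s : R) (x : 'cV[R]_d) : 'I_d.+1 -> R :=
  snoc (fun i => x i 0) s.

(* msize is the degree plus one. *)
Definition has_degree (D : nat) (U : {mpoly R[d]}) : Prop := msize U = D.+1.

Definition gradient (U : {mpoly R[d]}) (x : 'cV[R]_d) : 'cV[R]_d :=
  \col_i (U^`M(i)).@[fun j => x j 0].

(* The homogenizing variable s is the last one, 'X_ord_max; the coordinate x_i
   becomes the variable of index lift ord_max i. *)
Definition homogenization (D : nat) (U : {mpoly R[d]}) : {mpoly R[d.+1]} :=
  \sum_(j < D.+1) 'X_ord_max ^+ (D - j) * mwiden (pihomog mdeg j U).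

Definition gradient_x (W : {mpoly R[d.+1]}) (s : R) (x : 'cV[R]_d) : 'cV[R]_d :=
  \col_(i < d) (W^`M(lift ord_max i)).@[hpoint s x].

(* S is the set of positions i_1 - n, ..., i_m - n inside the window
   z = (x_n, ..., x_{n+k}).  Going through the homogenization covers every
   polynomial of degree at most k + 2; for homogeneous U see gradK_homog. *)
Definition gradK (k : nat) (U : {mpoly R[d]}) (z : 'I_k.+1 -> 'cV[R]_d) :
    'cV[R]_d :=
  \sum_(S : {set 'I_k.+1} | (0 < #|S|)%N)
    ((-1) ^+ (k.+1 - #|S|) / (k.+1)`!%:R) *:
      gradient_x (homogenization k.+2 U) #|S|%:R (\sum_(i in S) z i).

(* gradKE: nabla_K U (X, y) = gradK_lin U X *m y + gradK_const U X, i.e. these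
   are B_n and l_n as functions of the history X = (x_n, ..., x_{n+k-1}). *)
Definition gradK_const (k : nat) (U : {mpoly R[d]}) (X : 'I_k -> 'cV[R]_d) :
    'cV[R]_d :=
  gradK U (snoc X 0).

Definition gradK_lin (k : nat) (U : {mpoly R[d]}) (X : 'I_k -> 'cV[R]_d) :
    'M[R]_d :=
  \matrix_(i, j) (gradK U (snoc X (delta_mx j 0)) - gradK_const U X) i 0.

Lemma mwiden_homog n (p : {mpoly R[d]}) :
  p \is n.-homog -> mwiden p \is n.-homog.
Proof.
move=> /dhomogP hp; rewrite (mpolyE p) raddf_sum /= big_seq.
apply: rpred_sum => m /hp hm; rewrite mwidenZ mwidenX.
have hX : 'X_[mnmwiden m] \is [in R[d.+1], n.-homog].
  rewrite dhomogX -hm /= !mdegE big_ord_recr /= mnmwiden_ordmax addn0.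
  by apply/eqP/eq_bigr => i _; rewrite mnmwiden_widen.
exact: dhomogZ.
Qed.

Lemma homogenization_homog D (U : {mpoly R[d]}) :
  homogenization D U \is D.-homog.
Proof.
apply: rpred_sum => j _.
have hX : ('X_ord_max ^+ (D - j) : {mpoly R[d.+1]}) \is (1 * (D - j)).-homog.
  by apply: dhomogMn; rewrite dhomogX /= mdeg1.
have := dhomogM hX (mwiden_homog (pihomogP mdeg j U)).
by rewrite mul1n subnK // -ltnS.
Qed.

Lemma widenE (i : 'I_d) : widen_ord (leqnSn d) i = lift ord_max i.
Proof. by apply/val_inj; rewrite /= /bump leqNgt ltn_ord. Qed.

Lemma mwiden_point (p : {mpoly R[d]}) s x :
  (mwiden p).@[hpoint s x] = p.@[fun j => x j 0].
Proof.
rewrite (mpolyE p) [mwiden _]raddf_sum /= !raddf_sum /=; apply: eq_bigr => m _.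
rewrite mwidenZ mwidenX !mevalZ !mevalX big_ord_recr /= mnmwiden_ordmax expr0.
rewrite mulr1; congr (_ * _); apply: eq_bigr => i _.
by rewrite mnmwiden_widen widenE /hpoint snoc_lift.
Qed.

Lemma homogenizationE D (U : {mpoly R[d]}) (x : 'cV[R]_d) :
  (msize U <= D.+1)%N ->
  (homogenization D U).@[hpoint 1 x] = U.@[fun j => x j 0].
Proof.
move=> hU; rewrite {2}(pihomog_partitionE (mf := mdeg) hU).
rewrite !raddf_sum /=; apply: eq_bigr => j _.
by rewrite mevalM rmorphXn /= mevalXU /hpoint snoc_max expr1n mul1r mwiden_point.
Qed.

Lemma mderiv_mwiden (p : {mpoly R[d]}) i :
  (mwiden p)^`M(lift ord_max i) = mwiden p^`M(i).
Proof.
rewrite (mpolyE p) [X in X^`M(_)]raddf_sum [mderiv i _]raddf_sum /=.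
rewrite [LHS]raddf_sum [RHS]raddf_sum /=; apply: eq_bigr => m _.
rewrite mwidenZ mwidenX !mderivZ mwidenZ !mderivX mwidenZ mwidenX -widenE.
rewrite mnmwiden_widen; congr (_ *: (_ *: 'X_[_])).
apply/mnmP => j; rewrite mnmBE -mnmwiden1.
case: (unliftP ord_max j) => [j' ->|->].
  by rewrite -!widenE !mnmwiden_widen mnmBE.
by rewrite !mnmwiden_ordmax.
Qed.

Lemma gradK_homog k (U : {mpoly R[d]}) (z : 'I_k.+1 -> 'cV[R]_d) :
  U \is k.+2.-homog ->
  gradK U z = \sum_(S : {set 'I_k.+1} | (0 < #|S|)%N)
    ((-1) ^+ (k.+1 - #|S|) / (k.+1)`!%:R) *: gradient U (\sum_(i in S) z i).
Proof.
move=> hU; apply: eq_bigr => S _; congr (_ *: _).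
apply/matrixP => i j; rewrite !mxE -(mwiden_point _ #|S|%:R) -mderiv_mwiden.
congr ((_ ^`M(_)).@[_]); rewrite /homogenization (bigD1 ord_max) //=.
rewrite subnn expr0 mul1r pihomog_dE // big1 ?addr0 // => l hl.
by rewrite (@pihomog_ne0 _ _ mdeg k.+2) // ?raddf0 ?mulr0 // eq_sym.
Qed.

Lemma mnm_seq k (m : 'X_{1..d.+1}) : mdeg m = k ->
  exists c : 'I_k -> 'I_d.+1,
    forall v : 'I_d.+1 -> R, \prod_i v i ^+ m i = \prod_t v (c t).
Proof.
elim: k m => [|k IH] m hm.
  have c : 'I_0 -> 'I_d.+1 by case.
  exists c => v; rewrite big_ord0 big1 // => i _.
  by move/eqP: hm; rewrite mdeg_eq0 => /eqP ->; rewrite mnm0E.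
have [i mi] : exists i, (0 < m i)%N.
  apply/existsP; apply: contraT; rewrite negb_exists => /forallP h.
  suff : mdeg m = 0%N by rewrite hm.
  by rewrite mdegE big1 // => i _; apply/eqP; rewrite -leqn0 leqNgt.
have im : (U_(i) <= m)%MM.
  by apply/mnm_lepP => j; rewrite mnmE; case: eqP => [<-|].
have [|c hc] := IH (m - U_(i))%MM.
  by have := mdegD (m - U_(i)) U_(i); rewrite submK // hm mdeg1 addn1 => -[].
exists (fun t => if unlift ord0 t is Some s then c s else i) => v.
rewrite [RHS]big_ord_recl unlift_none; under [X in _ = _ * X]eq_bigr do rewrite liftK.
rewrite -hc -{1}(submK im) (bigD1 i) //= [in RHS](bigD1 i) //= mulrA.
rewrite mnmDE mnm1E eqxx addn1 exprS; congr (_ * _).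
by apply: eq_bigr => j ji; rewrite mnmDE mnm1E eq_sym (negPf ji) addn0.
Qed.

Lemma gradKE k (U : {mpoly R[d]}) (X : 'I_k -> 'cV[R]_d) (y : 'cV[R]_d) :
  gradK U (snoc X y) = gradK_lin U X *m y + gradK_const U X.
Proof.
suff aff i : affine (fun y => gradK U (snoc X y) i 0).
  apply/matrixP => i j; rewrite (ord1 j) aff !mxE; congr (_ + _).
  by apply: eq_bigr => l _; rewrite !mxE.
set W := (homogenization k.+2 U)^`M(lift ord_max i).
have hW : {in msupp W, forall m, mdeg m = k.+1}.
  move=> m mW; have mU : (m + U_(lift ord_max i))%MM \in msupp (homogenization k.+2 U).
    rewrite mcoeff_msupp; apply: contraTneq mW => h.
    by rewrite mcoeff_msupp mcoeff_deriv h mul0rn eqxx.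
  have /dhomogP/(_ _ mU)/= := homogenization_homog k.+2 U.
  by rewrite mdegD mdeg1 addn1 => -[].
apply: (@affine_eq _ _ _ (fun y => \sum_(m <- msupp W | m \in msupp W)
   ((k.+1)`!%:R^-1 * W@_m) * \sum_(S : {set 'I_k.+1} | (0 < #|S|)%N)
      (-1) ^+ (k.+1 - #|S|) * \prod_j (\sum_(i in S) hpoint 1 (snoc X y i) j) ^+ m j)).
  move=> {}y; rewrite summxE.
  under [RHS]eq_bigr do rewrite mulr_sumr.
  rewrite exchange_big /=; apply: eq_bigr => S _.
  rewrite !mxE mevalE big_seq mulr_sumr; apply: eq_bigr => m _.
  have -> : \prod_j hpoint #|S|%:R (\sum_(i in S) snoc X y i) j ^+ m j =
     \prod_j (\sum_(i in S) hpoint 1 (snoc X y i) j) ^+ m j.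
    apply: eq_bigr => j _; congr (_ ^+ _); rewrite /hpoint.
    case: (unliftP ord_max j) => [j' ->|->].
      by rewrite snoc_lift summxE; apply: eq_bigr => l _; rewrite snoc_lift.
    by rewrite snoc_max; under eq_bigr do rewrite snoc_max; rewrite sumr_const.
  by rewrite mulrA [(-1) ^+ _ / _]mulrC mulrACA mulrA -!mulrA.
apply: affine_sum => m mW; apply: affine_mull.
have [c hc] := mnm_seq (hW _ mW).
apply: (@affine_eq _ _ _ (fun y => \sum_(f : {ffun 'I_k.+1 -> 'I_k.+1} | injectiveb f)
   \prod_t hpoint 1 (snoc X y (f t)) (c t))).
  move=> {}y.
  rewrite -(polarization (fun t i => hpoint 1 (snoc X y i) (c t))).
  by apply: eq_bigr => S _; rewrite hc.
apply: affine_sum => f /injectiveP fi.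
have [t0 ft0] : exists t, f t = ord_max.
  by exists (invF fi ord_max); rewrite f_invF.
apply: (@affine_eq _ _ _ (fun y => (\prod_(t | t != t0) hpoint 1 (snoc X 0 (f t)) (c t))
    * hpoint 1 y (c t0))).
  move=> {}y; rewrite (bigD1 t0) //= ft0 snoc_max mulrC; congr (_ * _).
  apply: eq_bigr => t tt0; congr (hpoint 1 _ _).
  case: (unliftP ord_max (f t)) => [j ->|e]; first by rewrite !snoc_lift.
  by case/eqP: tt0; apply: fi; rewrite e.
apply: affine_mull; case: (unliftP ord_max (c t0)) => [j ->|->].
  apply: (@affine_eq _ _ _ (fun y => y j 0)); last exact: affine_coord.
  by move=> {}y; rewrite /hpoint snoc_lift.
apply: (@affine_eq _ _ _ (fun=> 1)); last exact: affine_cst.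
by move=> {}y; rewrite /hpoint snoc_max.
Qed.

End PolarizedGradient.

From mathcomp Require Import all_classical all_reals all_analysis.
Import numFieldNormedType.Exports.
Local Open Scope classical_set_scope.
Local Open Scope ring_scope.

Section Norms.
Context {R : realType} {d : nat}.

Record is_norm (N : 'cV[R]_d -> R) : Prop := IsNorm {
  norm_triangle : forall x y, N (x + y) <= N x + N y;
  norm_homogeneous : forall a x, N (a *: x) = `|a| * N x;
  norm_definite : forall x, N x = 0 -> x = 0
}.

Definition opnorm (N : 'cV[R]_d -> R) (A : 'M[R]_d) : R :=
  sup [set N (A *m x) | x in [set x | N x <= 1]].

Definition tuple_norm (N : 'cV[R]_d -> R) {m : nat} (X : 'I_m -> 'cV[R]_d) : R :=
  \big[Num.max/0]_(j < m) N (X j).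

Definition bounded_histories (N : 'cV[R]_d -> R) {m : nat}
    (K : set ('I_m -> 'cV[R]_d)) : Prop :=
  exists r : R, forall X, K X -> tuple_norm N X <= r.

Definition lipschitz_on_histories (N : 'cV[R]_d -> R) {m : nat}
    (K : set ('I_m -> 'cV[R]_d)) {V : zmodType} (NV : V -> R)
    (f : ('I_m -> 'cV[R]_d) -> V) : Prop :=
  exists L : R, forall X Y, K X -> K Y ->
    NV (f X - f Y) <= L * tuple_norm N (X \- Y).

End Norms.

Section EKahan.
Context {R : realType} {d : nat}.

Definition expmx (A : 'M[R]_d) : 'M[R]_d :=
  limn (series (fun m : nat => (m`!%:R)^-1 *: A ^+ m)).

(* phi(z) = (e^z - 1) / z = \sum_m z^m / (m+1)! *)
Definition phimx (A : 'M[R]_d) : 'M[R]_d :=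
  limn (series (fun m : nat => (m.+1`!%:R)^-1 *: A ^+ m)).

Definition ekahan_step (k : nat) (A Q : 'M[R]_d) (U : mpoly.mpoly d R) (h : R)
    (z : 'I_k.+1 -> 'cV[R]_d) : Prop :=
  z ord_max = expmx ((k%:R * h) *: A) *m z ord0
              + (k%:R * h) *: (phimx ((k%:R * h) *: A) *m (Q *m gradK U z)).

Definition window (x : nat -> 'cV[R]_d) (m n : nat) : 'I_m -> 'cV[R]_d :=
  fun j => x (n + j)%N.
Arguments window : clear implicits.

(* Numerical solution over [0, T] with all its histories in K: the values
   x_0, ..., x_{N+k-1}, where N h <= T < (N+1) h, are constrained; later values
   of the sequence x are irrelevant. *)
Definition ekahan_solution (k : nat) (A Q : 'M[R]_d) (U : mpoly.mpoly d R)
    (T h : R) (K : set ('I_k -> 'cV[R]_d)) (x : nat -> 'cV[R]_d) : Prop :=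
  (forall n : nat, n.+1%:R * h <= T -> ekahan_step A Q U h (window x k.+1 n)) /\
  (forall n : nat, n%:R * h <= T -> K (window x k n)).

End EKahan.

Arguments window {R d} x m n.

(* Main.v *)
Require Import Defs.
From HB Require Import structures.
From mathcomp Require Import all_boot all_order all_algebra.
From mathcomp Require mpoly.
From mathcomp Require Import all_classical all_reals all_analysis.
From mathcomp Require Import ring lra.
Set Implicit Arguments.
Unset Strict Implicit.
Unset Printing Implicit Defensive.
Import Order.TTheory GRing.Theory Num.Theory numFieldNormedType.Exports.
Local Open Scope classical_set_scope.
Local Open Scope ring_scope.

(** Why the theorem holds.  Put t = k h.  Since nabla_K U is affine in its last
    argument, the scheme is a linear equation for the new value y,
      y = e^(tA) x_n + t phi(tA) Q (B_n y + l_n),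
    whose matrix is the identity minus t phi(tA) Q B_n.  On bounded ranges of t
    the factor phi(tA) Q is bounded by some beta, so as soon as
    t (1 + 2 beta |M_B|) <= 1 the map y |-> t phi(tA) Q B_n y contracts by 1/2 and
    the equation has exactly one solution [contraction_solve].

    For stability, subtract the equations of two solutions.  The difference of
    the products B_n y is B_n (y - y~) + (B_n - B~_n) y~: the first term is
    absorbed in the left-hand side by the smallness of t, the second is
    controlled by the Lipschitz constant of B_n and by the bound on y~, which is
    an entry of the next history and hence lies in a bounded set.  What matters is
    that the factor in front of x_n - x~_n is 1 + O(t) and not merely bounded,
    that is, |e^(tA)| <= 1 + t r [propagator_bounds].  Then
    the error of the new value is at most 1 + O(h) times the error of the current
    history [linearly_implicit_perturbation]; taking the maximum over the window
    keeps that factor [tuple_norm_window_succ],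
    and n <= T / h steps accumulate to e^(O(T)) [growth_le_expR].

    All matrix estimates are made in the entrywise maximum norm, for which power
    series of matrices are easy to bound, and are transferred to the given norm N
    by the equivalence of norms on R^d; that equivalence also makes the supremum
    defining the induced matrix norm finite, which is what gives
    N (X v) <= |X| N v [norm_le_opnorm]. *)

(** * Matrix power series in the maximum norm *)

(** Completeness and the normed module structure of square matrices are combined
    here, so that absolutely convergent series of matrices converge. *)
HB.instance Definition _ (R : realType) (d : nat) :=
  Complete.copy 'M[R]_d 'M[R]_d.

Section MaxNorm.
Context {R : realType}.

Lemma mx_norm_ge_entry m n (X : 'M[R]_(m, n)) i j : `|X i j| <= `|X|.
Proof.
rewrite [leRHS]/Num.norm /= mx_normrE.
exact: (le_bigmax _ (fun ij : 'I_m * 'I_n => `|X ij.1 ij.2|) (i, j)).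
Qed.

Lemma mx_norm_le m n (X : 'M[R]_(m, n)) (c : R) :
  0 <= c -> (forall i j, `|X i j| <= c) -> `|X| <= c.
Proof.
move=> c0 h; rewrite /Num.norm /= mx_normrE.
by apply: bigmax_le => // -[i j] _; exact: h.
Qed.

Lemma mx_norm_mulmx m n p (X : 'M[R]_(m, n)) (Y : 'M[R]_(n, p)) :
  `|X *m Y| <= n%:R * `|X| * `|Y|.
Proof.
apply: mx_norm_le => [|i j]; first by rewrite !mulr_ge0.
rewrite mxE (le_trans (ler_norm_sum _ _ _))//.
apply: (@le_trans _ _ (\sum_(l < n) `|X| * `|Y|)).
  by apply: ler_sum => l _; rewrite normrM ler_pM// mx_norm_ge_entry.
by rewrite sumr_const card_ord -mulrA mulr_natl.
Qed.

Lemma mx_norm_exp d (X : 'M[R]_d) m : `|X ^+ m| <= (d%:R * `|X|) ^+ m.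
Proof.
elim: m => [|m IH].
  rewrite !expr0; apply: mx_norm_le => // i j.
  by rewrite mxE; case: (i == j); rewrite ?normr1// normr0.
rewrite exprS (le_trans (mx_norm_mulmx _ _))// exprS ler_wpM2l//.
Qed.

(** All terms but the first carry a factor t^m <= t, and those that remain are
    dominated by the exponential series of d |A|.  Having the same r for every
    coefficient sequence below 1/m! lets one lemma serve both exp and phi. *)
Lemma mx_power_series_near_const d (A : 'M[R]_d) :
  exists2 r : R, 0 <= r & forall (c : nat -> R) (t : R),
    (forall m, `|c m| <= (m`!%:R)^-1) -> 0 <= t <= 1 ->
    `|limn (series (fun m => c m *: (t *: A) ^+ m)) - (c 0)%:M| <= t * r.
Proof.
pose a := d%:R * `|A|; have a0 : 0 <= a by rewrite mulr_ge0.
exists (expR a) => [|c t hc /andP[t0 t1]]; first exact: expR_ge0.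
pose g m := c m *: (t *: A) ^+ m.
have gle m : `|g m| <= t ^+ m * exp_coeff a m.
  rewrite normrZ (le_trans (ler_pM _ _ (hc m) (mx_norm_exp _ _)))//.
  by rewrite normrZ (ger0_norm t0) mulrCA exprMn mulrC -/a mulrA.
have gle0 m : `|g m| <= exp_coeff a m.
  rewrite (le_trans (gle m))// ler_piMl// ?exprn_ile1//.
  exact: exp_coeff_ge0.
have cg : cvgn (series g).
  apply: (@normed_cvg R 'M[R]_d); apply: series_le_cvg gle0 _ => // m.
    exact: exp_coeff_ge0.
  exact: is_cvg_series_exp_coeff.
(* the bound is proved on partial sums and passes to the limit *)
have cg1 : (series g n - (c 0)%:M) @[n --> \oo] --> limn (series g) - (c 0)%:M.
  by apply: cvgB => //; exact: cvg_cst.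
rewrite -(cvg_lim _ (cvg_norm cg1))//; apply: limr_le.
  by apply: cvgP; exact: cvg_norm cg1.
near=> n; have n0 : (0 < n)%N by near: n; exists 1%N.
rewrite /series /= big_ltn// /g expr0 -scalemx1 addrAC subrr add0r.
apply: (@le_trans _ _ (t * series (exp_coeff a) n)); last first.
  rewrite ler_wpM2l//; apply: nondecreasing_cvgn_le.
    by apply: nondecreasing_series => i _ _; exact: exp_coeff_ge0.
  exact: is_cvg_series_exp_coeff.
rewrite (le_trans (ler_norm_sum _ _ _))// /series /= [X in _ * X]big_ltn// mulrDr.
rewrite -[leLHS]add0r lerD ?mulr_ge0 ?exp_coeff_ge0// mulr_sumr.
rewrite big_nat_cond [leRHS]big_nat_cond; apply: ler_sum => m /andP[/andP[m0 _] _].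
rewrite (le_trans (gle m))// ler_wpM2r ?exp_coeff_ge0//.
by rewrite -(prednK m0) exprS ler_piMr ?exprn_ile1.
Unshelve. all: by end_near. Qed.

End MaxNorm.

(** * Norms on column vectors and the induced matrix norm *)

Section NormEquivalence.
Context {R : realType} {d : nat} (N : 'cV[R]_d -> R) (hN : is_norm N).

Lemma norm0 : N 0 = 0.
Proof. by rewrite -(scale0r 0) norm_homogeneous// normr0 mul0r. Qed.

Lemma normN x : N (- x) = N x.
Proof. by rewrite -scaleN1r norm_homogeneous// normrN1 mul1r. Qed.

Lemma norm_ge0 x : 0 <= N x.
Proof.
have := norm_triangle hN x (- x).
by rewrite subrr norm0 normN -mulr2n pmulrn_lge0.
Qed.

Lemma norm_sum (I : Type) (r : seq I) (F : I -> 'cV[R]_d) :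
  N (\sum_(i <- r) F i) <= \sum_(i <- r) N (F i).
Proof.
elim/big_ind2 : _ => [|x a y b hx hy|//]; first by rewrite norm0.
by rewrite (le_trans (norm_triangle hN _ _))// lerD.
Qed.

Lemma norm_dist x y : `|N x - N y| <= N (x - y).
Proof.
have h a b : N a <= N (a - b) + N b.
  by have := norm_triangle hN (a - b) b; rewrite subrK.
have := h y x; have := h x y; rewrite -opprB normN ler_norml => h1 h2.
by apply/andP; split; lra.
Qed.

Lemma norm_le_maxnorm : exists2 c : R, 0 <= c & forall v, N v <= c * `|v|.
Proof.
exists (\sum_i N (delta_mx i 0)) => [|v].
  by apply: sumr_ge0 => i _; exact: norm_ge0.
rewrite {1}(matrix_sum_delta v) (le_trans (norm_sum _ _))// mulr_suml.
apply: ler_sum => i _; rewrite big_ord1 norm_homogeneous// mulrC.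
by rewrite ler_wpM2l ?norm_ge0// mx_norm_ge_entry.
Qed.

(** The unit sphere of the maximum norm is compact and N is continuous, so N
    attains a positive minimum there.  The transposes come from
    [bounded_closed_compact], which concerns row vectors. *)
Lemma maxnorm_le_norm :
  exists2 c : R, 0 <= c & forall v : 'cV[R]_d, `|v| <= c * N v.
Proof.
have [c c0 Nc] := norm_le_maxnorm.
have trE m n (X : 'M[R]_(m, n)) : `|X^T| <= `|X|.
  by apply: mx_norm_le => // i j; rewrite mxE mx_norm_ge_entry.
pose f (u : 'rV[R]_d) := N u^T; pose S := [set u : 'rV[R]_d | `|u| = 1].
have cf : continuous f.
  move=> u; apply/(@cvgrPdist_le _ R^o 'rV[R]_d (nbhs u) _ f) => e e0.
  have c1 : 0 < c + 1 by rewrite ltr_wpDl.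
  apply/nbhs_ballP; exists (e / (c + 1)) => [/=|w].
    by rewrite divr_gt0.
  rewrite mx_norm_ball /ball_/= => uw.
  rewrite /f (le_trans (norm_dist _ _))// -linearB/=.
  rewrite (le_trans (Nc _))// (le_trans (ler_wpM2l c0 (trE _ _ _)))//.
  apply: (@le_trans _ _ ((c + 1) * `|u - w|)).
    by rewrite ler_wpM2r// lerDl.
  by rewrite mulrC -ler_pdivlMr// ltW.
have Sc : compact S.
  apply: bounded_closed_compact.
    exists 1; split => // x x1 u /= ->; exact: ltW.
  have -> : S = (fun u : 'rV[R]_d => `|u|) @^-1` [set 1] by [].
  apply: closed_comp => [u _|]; last exact: closed_eq.
  exact: norm_continuous.
(* the sphere is empty exactly when d = 0, and then every v is 0 *)
have [S0|/set0P/negP/negPn/eqP S0] := pselect (S !=set0); last first.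
  exists 0 => // v; rewrite mul0r leNgt; apply/negP => v0.
  have vT0 : v^T != 0.
    by rewrite trmx_eq0; apply: contraTneq v0 => ->; rewrite normr0 ltxx.
  suff : S (`|v^T|^-1 *: v^T) by rewrite S0.
  by rewrite /S /= normrZ normfV normr_id mulVf// normr_eq0.
have [u /[!inE] u1 umin] := EVT_min_rV S0 Sc (continuous_subspaceT cf).
have fu : 0 < f u.
  rewrite lt_def norm_ge0 andbT; apply/eqP => /(norm_definite hN)/eqP.
  rewrite trmx_eq0 => /eqP u0; move: u1; rewrite /S/= u0 normr0 => /esym/eqP.
  by rewrite oner_eq0.
exists (f u)^-1 => [|v]; first by rewrite invr_ge0 ltW.
rewrite mulrC ler_pdivlMr//.
have [->|v0] := eqVneq v 0; first by rewrite normr0 mul0r norm_ge0.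
have vT0 : 0 < `|v^T| by rewrite normr_gt0 trmx_eq0.
have /umin : `|v^T|^-1 *: v^T \in S.
  by rewrite inE /S /= normrZ normfV normr_id mulVf// gt_eqF.
rewrite {2}/f linearZ/= trmxK norm_homogeneous// normfV normr_id.
rewrite [leRHS]mulrC ler_pdivlMr// => h; rewrite mulrC (le_trans _ h)//.
by rewrite ler_wpM2l ?(ltW fu)//; have := trE _ _ v^T; rewrite trmxK.
Qed.

Lemma norm_mulmx_le :
  exists2 c : R, 0 <= c & forall (X : 'M[R]_d) v, N (X *m v) <= c * `|X| * N v.
Proof.
have [c c0 Nc] := norm_le_maxnorm; have [b b0 bN] := maxnorm_le_norm.
exists (c * d%:R * b) => [|X v]; first by rewrite !mulr_ge0.
rewrite (le_trans (Nc _))// (le_trans (ler_wpM2l c0 (mx_norm_mulmx _ _)))//.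
rewrite (le_trans (ler_wpM2l c0 (ler_wpM2l _ (bN v))))// ?mulr_ge0//.
by rewrite le_eqVlt; apply/orP; left; apply/eqP; ring.
Qed.

(** Without [norm_mulmx_le] the set whose supremum is [opnorm N X] might be
    unbounded, and its supremum would be a default value that bounds nothing. *)
Lemma norm_le_opnorm (X : 'M[R]_d) v : N (X *m v) <= opnorm N X * N v.
Proof.
have [c c0 Nc] := norm_mulmx_le.
have [->|v0] := eqVneq v 0; first by rewrite mulmx0 norm0 mulr0.
have Nv : 0 < N v.
  rewrite lt_def norm_ge0 andbT; apply: contra_neq v0; exact: norm_definite.
have : N (X *m ((N v)^-1 *: v)) <= opnorm N X.
  apply: ub_le_sup; last first.
    exists ((N v)^-1 *: v) => //=.
    by rewrite norm_homogeneous// normfV ger0_norm ?norm_ge0// mulVf// gt_eqF.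
  exists (c * `|X|) => _ [w /= w1 <-].
  by rewrite (le_trans (Nc _ _))// ler_piMr// mulr_ge0.
rewrite -scalemxAr norm_homogeneous// normfV ger0_norm ?norm_ge0//.
by rewrite mulrC ler_pdivrMr.
Qed.

End NormEquivalence.

(** * One linearly implicit step *)

Section LinearSolve.
Context {R : realType} {d : nat} (N : 'cV[R]_d -> R) (hN : is_norm N).

(** In finite dimension it suffices that 1 - G is injective: v = G v forces
    N v <= a N v, hence v = 0. *)
Lemma contraction_solve (G : 'M[R]_d) (a : R) (w : 'cV[R]_d) :
  a < 1 -> (forall v, N (G *m v) <= a * N v) ->
  exists! y, y = w + G *m y.
Proof.
move=> a1 Ga.
have inj (v : 'cV[R]_d) : v = G *m v -> v = 0.
  move=> e; apply: (norm_definite hN); have := Ga v; rewrite -e => h.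
  have := norm_ge0 hN v; nra.
have uG : 1%:M - G \in unitmx.
  rewrite -unitmx_tr -row_free_unit; apply: inj_row_free => u /(congr1 trmx).
  rewrite trmx_mul trmxK trmx0 mulmxBl mul1mx => /subr0_eq/inj.
  by move/(congr1 trmx); rewrite trmxK trmx0.
have solE y : y = w + G *m y <-> y = invmx (1%:M - G) *m w.
  split=> [e|->].
    have -> : w = (1%:M - G) *m y by rewrite mulmxBl mul1mx {1}e addrK.
    by rewrite mulKmx.
  apply/eqP; rewrite -subr_eq -{1}[invmx _ *m w]mul1mx -mulmxBl.
  by rewrite mulKVmx.
by exists (invmx (1%:M - G) *m w); split=> [|y /solE ->]; first exact/solE.
Qed.

(** The unknown error y - y' occurs on both sides with the factor
    a = t beta mu <= 1/2 on the right; moving it to the left costs a division by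
    1 - a, which is still 1 + O(t).  Only the perturbed value y' has to be
    bounded a priori, because the error of the product B y is split as
    B (y - y') + (B - B') y'. *)
Lemma linearly_implicit_perturbation (E W B B' : 'M[R]_d)
    (x x' y y' l l' : 'cV[R]_d) (t e alpha beta mu lam lam' r : R) :
  0 <= t -> t * (1 + 2 * beta * mu) <= 1 ->
  0 <= alpha -> 0 <= beta -> 0 <= mu -> 0 <= lam -> 0 <= lam' ->
  (forall v, N (E *m v) <= (1 + t * alpha) * N v) ->
  (forall v, N (W *m v) <= beta * N v) ->
  (forall v, N (B *m v) <= mu * N v) ->
  (forall v, N ((B - B') *m v) <= lam * e * N v) ->
  N (l - l') <= lam' * e -> N (x - x') <= e -> N y' <= r ->
  y = E *m x + t *: (W *m (B *m y + l)) ->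
  y' = E *m x' + t *: (W *m (B' *m y' + l')) ->
  N (y - y')
    <= (1 + t * (2 * beta * mu + 2 * (alpha + beta * (lam * r + lam')))) * e.
Proof.
move=> t0 t1 al0 be0 mu0 la0 la'0 hE hW hB hBB hll hxx hy' ey ey'.
have e0 : 0 <= e := le_trans (norm_ge0 hN _) hxx.
have r0 : 0 <= r := le_trans (norm_ge0 hN _) hy'.
have split_err : y - y' = E *m (x - x')
    + t *: (W *m (B *m (y - y') + ((B - B') *m y' + (l - l')))).
  rewrite {1}ey {1}ey' opprD addrACA -mulmxBr -scalerBr -mulmxBr.
  congr (_ + _ *: (_ *m _)); rewrite mulmxBr mulmxBl.
  by rewrite [RHS]addrA subrKA addrACA -opprD.
pose n := N (y - y'); have n0 : 0 <= n := norm_ge0 hN _.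
have inner : N (B *m (y - y') + ((B - B') *m y' + (l - l')))
    <= mu * n + (lam * e * r + lam' * e).
  rewrite (le_trans (norm_triangle hN _ _))// lerD//.
  rewrite (le_trans (norm_triangle hN _ _))// lerD//.
  by rewrite (le_trans (hBB _))// ler_wpM2l// mulr_ge0.
have main : n <= (1 + t * alpha) * e
    + t * (beta * (mu * n + (lam * e * r + lam' * e))).
  rewrite {1}/n split_err (le_trans (norm_triangle hN _ _))// lerD//.
    by rewrite (le_trans (hE _))// ler_wpM2l// addr_ge0// mulr_ge0.
  rewrite norm_homogeneous// ger0_norm// ler_wpM2l//.
  by rewrite (le_trans (hW _))// ler_wpM2l.
pose a := t * beta * mu; pose s := t * (alpha + beta * (lam * r + lam')).
have a0 : 0 <= a by rewrite !mulr_ge0.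
have s0 : 0 <= s by rewrite mulr_ge0// addr_ge0// mulr_ge0// addr_ge0// mulr_ge0.
have a12 : 2 * a + t <= 1.
  by rewrite (le_trans _ t1)// le_eqVlt; apply/orP; left; apply/eqP; rewrite /a; ring.
have h1 : n * (1 - a) <= (1 + s) * e.
  rewrite mulrBr mulr1 lerBlDr (le_trans main)// le_eqVlt; apply/orP; left.
  by apply/eqP; rewrite /a /s; ring.
have a2 : 2 * a <= 1 by rewrite (le_trans _ a12)// lerDl.
(* 1 / (1 - a) <= 1 + 2 a because a <= 1 / 2 *)
have h2 : n <= (1 + 2 * a) * ((1 + s) * e).
  have : n * 1 <= n * ((1 - a) * (1 + 2 * a)) by rewrite ler_wpM2l//; nra.
  rewrite mulr1 => /le_trans; apply.
  rewrite [leLHS]mulrA [leLHS]mulrC ler_wpM2l//; lra.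
rewrite -/n (le_trans h2)// mulrA ler_wpM2r//.
(* (1 + 2 a) (1 + s) <= 1 + 2 a + 2 s because 2 a <= 1 *)
have -> : 1 + t * (2 * beta * mu + 2 * (alpha + beta * (lam * r + lam')))
    = 1 + 2 * a + 2 * s by rewrite /a /s; ring.
nra.
Qed.

End LinearSolve.

(** * Error propagation along history windows *)

Section Histories.
Context {R : realType} {d : nat} (N : 'cV[R]_d -> R).

Lemma le_tuple_norm m (X : 'I_m -> 'cV[R]_d) j : N (X j) <= tuple_norm N X.
Proof. exact: (le_bigmax _ (fun j => N (X j))). Qed.

Lemma tuple_norm_ge0 m (X : 'I_m -> 'cV[R]_d) : 0 <= tuple_norm N X.
Proof. exact: bigmax_ge_id. Qed.

Lemma window_snoc (x : nat -> 'cV[R]_d) k n :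
  window x k.+1 n = snoc (window x k n) (x (n + k)%N).
Proof.
apply/funext => j; case: (unliftP ord_max j) => [i ->|->].
  by rewrite snoc_lift /window lift_max.
by rewrite snoc_max.
Qed.

(** The shifted window keeps all entries of the old one but the oldest and adds
    one new value, so it is enough to estimate that value; 1 <= c covers the
    entries that are kept. *)
Lemma tuple_norm_window_succ k (x y : nat -> 'cV[R]_d) n (c : R) :
  1 <= c ->
  N (x (n + k)%N - y (n + k)%N)
    <= c * tuple_norm N (window x k n \- window y k n) ->
  tuple_norm N (window x k n.+1 \- window y k n.+1)
    <= c * tuple_norm N (window x k n \- window y k n).
Proof.
move=> c1 h; have c0 : 0 <= c by rewrite (le_trans _ c1).
apply: bigmax_le => [|j _]; first by rewrite mulr_ge0// tuple_norm_ge0.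
rewrite /window /= addSnnS.
have [jk|jk] := ltnP j.+1 k; last first.
  by have -> : j.+1 = k by apply/eqP; rewrite eqn_leq jk ltn_ord.
have := @le_tuple_norm _ (window x k n \- window y k n) (Ordinal jk).
by move=> /le_trans; apply; rewrite ler_peMl// tuple_norm_ge0.
Qed.

(** Discrete Gronwall inequality: (1 + g h)^n <= e^(g n h) <= e^(g T). *)
Lemma growth_le_expR (u : nat -> R) (g h T : R) :
  0 <= g -> 0 <= h -> (forall n, 0 <= u n) ->
  (forall n, n.+1%:R * h <= T -> u n.+1 <= (1 + g * h) * u n) ->
  forall n, n%:R * h <= T -> u n <= expR (g * T) * u 0%N.
Proof.
move=> g0 h0 u0 step n nT.
have pow m : (m <= n)%N -> u m <= (1 + g * h) ^+ m * u 0%N.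
  elim: m => [|m IH] mn; first by rewrite expr0 mul1r.
  rewrite (le_trans (step _ _))// ?(le_trans _ nT) ?ler_wpM2r ?ler_nat//.
  rewrite exprS -mulrA ler_wpM2l ?IH 1?ltnW//.
  by rewrite addr_ge0// mulr_ge0.
rewrite (le_trans (pow n _))// ler_wpM2r//.
apply: (@le_trans _ _ (expR (g * h) ^+ n)).
  by rewrite lerXn2r ?nnegrE ?expR_ge0 ?addr_ge0 ?mulr_ge0// expR_ge1Dx.
rewrite -expRM_natr ler_expR -mulrA ler_wpM2l//.
by rewrite mulrC.
Qed.

End Histories.

(** * The EKahan scheme *)

(** Both e^z and phi(z) have constant coefficient 1 and coefficients at most 1/m!,
    so at tA both are within O(t) of the identity. *)
Lemma propagator_bounds (R : realType) (d : nat) (N : 'cV[R]_d -> R)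
    (hN : is_norm N) (A : 'M[R]_d) :
  exists2 r : R, 0 <= r & forall t, 0 <= t <= 1 ->
    (forall v, N (expmx (t *: A) *m v) <= (1 + t * r) * N v) /\
    (forall v, N (phimx (t *: A) *m v) <= (1 + t * r) * N v).
Proof.
have [r r0 near_const] := mx_power_series_near_const A.
have [b b0 hb] := norm_mulmx_le hN.
have near1 (t : R) (X : 'M[R]_d) v : `|X - 1%:M| <= t * r ->
    N (X *m v) <= (1 + t * (b * r)) * N v.
  move=> Xr; rewrite -[X](subrK 1%:M) mulmxDl mul1mx addrC.
  rewrite (le_trans (norm_triangle hN _ _))// mulrDl mul1r lerD2l.
  by rewrite (le_trans (hb _ _))// ler_wpM2r ?norm_ge0// mulrCA ler_wpM2l.
exists (b * r) => [|t t01]; first by rewrite mulr_ge0.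
split=> v; apply: near1.
- have := near_const (fun m => (m`!%:R)^-1) t _ t01; rewrite fact0 invr1; apply.
  by move=> m; rewrite ger0_norm// invr_ge0.
- have := near_const (fun m => (m.+1`!%:R)^-1) t _ t01.
  rewrite factS fact0 muln1 invr1; apply.
  move=> m; rewrite ger0_norm ?invr_ge0// lef_pV2 ?posrE ?ltr0n ?fact_gt0//.
  by rewrite ler_nat factS leq_pmull.
Qed.

Lemma ekahan_step_linear (R : realType) (d k : nat) (A Q : 'M[R]_d)
    (U : mpoly.mpoly d R) (h : R) (i0 : 'I_k) (X : 'I_k -> 'cV[R]_d)
    (y : 'cV[R]_d) : val i0 = 0%N ->
  ekahan_step A Q U h (snoc X y) <->
  y = expmx ((k%:R * h) *: A) *m X i0
      + (k%:R * h) *: (phimx ((k%:R * h) *: A) *m Q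
                        *m (gradK_lin U X *m y + gradK_const U X)).
Proof.
move=> i00; have -> : X i0 = snoc X y ord0.
  rewrite -(snoc_lift X y); congr (snoc X y); apply: val_inj.
  by rewrite /= i00 /bump leqNgt -i00 ltn_ord.
by rewrite /ekahan_step snoc_max gradKE mulmxA.
Qed.

Theorem theorem3 (R : realType) (d k : nat) (hk : (1 <= k)%N)
    (N : 'cV[R]_d -> R) (hN : is_norm N)
    (Q M : 'M[R]_d) (hQ : Q^T = - Q) (hM : M^T = M)
    (T : R) (hT : 0 < T)
    (U : mpoly.mpoly d R) (hU : has_degree k.+2 U)
    (K : set ('I_k -> 'cV[R]_d)) (hK : bounded_histories N K)
    (MB : R) (hMB : forall X, K X -> opnorm N (gradK_lin U X) <= MB)
    (hB : lipschitz_on_histories N K (opnorm N) (gradK_lin U))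
    (hl : lipschitz_on_histories N K N (gradK_const U)) :
  exists h0 C : R, [/\ 0 < h0, 0 < C &
    forall h : R, 0 < h -> h <= h0 ->
      (forall X, K X ->
         exists! y : 'cV[R]_d, ekahan_step (Q *m M) Q U h (snoc X y)) /\
      (forall x xt : nat -> 'cV[R]_d,
         ekahan_solution (Q *m M) Q U T h K x ->
         ekahan_solution (Q *m M) Q U T h K xt ->
         forall n : nat, n%:R * h <= T ->
           tuple_norm N (window x k n \- window xt k n)
             <= C * tuple_norm N (window x k 0 \- window xt k 0))].
Proof.
have [r r0 hprop] := propagator_bounds hN (Q *m M).
pose t h : R := k%:R * h; have k0 : 0 < k%:R :> R by rewrite ltr0n.
pose i0 : 'I_k := Ordinal hk.
have stepE X h y := @ekahan_step_linear R d k (Q *m M) Q U h i0 X y erefl.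
have oQ0 : 0 <= `|opnorm N Q| by [].
pose beta := (1 + r) * `|opnorm N Q|.
have beta0 : 0 <= beta by rewrite mulr_ge0// addr_ge0.
have [LB hLB] := hB; have [Ll hLl] := hl; have [rK hrK] := hK.
have hE h v : 0 <= t h <= 1 ->
    N (expmx (t h *: (Q *m M)) *m v) <= (1 + t h * r) * N v.
  by move=> t01; exact: (hprop _ t01).1.
have hW h v : 0 <= t h <= 1 ->
    N (phimx (t h *: (Q *m M)) *m Q *m v) <= beta * N v.
  move=> t01; rewrite -mulmxA (le_trans ((hprop _ t01).2 _))// /beta -mulrA.
  have /andP[t0 t1] := t01.
  have tr0 : 0 <= t h * r by exact: mulr_ge0.
  rewrite ler_pM ?(norm_ge0 hN)// ?addr_ge0 ?lerD2l ?ler_piMl//.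
  by rewrite (le_trans (norm_le_opnorm hN _ _))// ler_wpM2r ?norm_ge0// ler_norm.
clearbody beta.
have hBX X v : K X -> N (gradK_lin U X *m v) <= `|MB| * N v.
  move=> KX; rewrite (le_trans (norm_le_opnorm hN _ _))// ler_wpM2r ?norm_ge0//.
  by rewrite (le_trans (hMB _ KX))// ler_norm.
(* c is the constant of the smallness condition t c <= 1, g the growth rate per
   unit of t = k h given by the one-step estimate *)
pose c := 1 + 2 * beta * `|MB|.
have c1 : 1 <= c by rewrite lerDl !mulr_ge0.
have c0 : 0 < c by rewrite (lt_le_trans _ c1).
pose g := 2 * beta * `|MB| + 2 * (r + beta * (`|LB| * `|rK| + `|Ll|)).
have g0 : 0 <= g by rewrite !(addr_ge0, mulr_ge0).
exists (k%:R * c)^-1, (expR (g * k%:R * T)).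
split; [by rewrite invr_gt0 mulr_gt0|exact: expR_gt0|move=> h h0 hh0].
have th0 : 0 <= t h by rewrite mulr_ge0// ltW.
have thc : t h * c <= 1.
  by rewrite mulrAC -ler_pdivlMl ?mulr_gt0// mulr1.
have th01 : 0 <= t h <= 1 by rewrite th0 (le_trans _ thc)// ler_peMr.
split=> [X KX|x xt [xS xK] [xtS xtK]].
  have [|v|y [ey uy]] := @contraction_solve _ _ _ hN
      (t h *: (phimx (t h *: (Q *m M)) *m Q *m gradK_lin U X))
      (t h * beta * `|MB|)
      (expmx (t h *: (Q *m M)) *m X i0
       + t h *: (phimx (t h *: (Q *m M)) *m Q *m gradK_const U X)).
  - move: thc; rewrite /c; have := mulr_ge0 (mulr_ge0 th0 beta0) (normr_ge0 MB).
    by nra.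
  - rewrite -scalemxAl norm_homogeneous// ger0_norm//.
    rewrite -(mulrA (t h * beta)) -(mulrA (t h)) ler_wpM2l//.
    rewrite -mulmxA (le_trans (hW _ _ th01))// ler_wpM2l//; exact: hBX.
  - have stepE' z : ekahan_step (Q *m M) Q U h (snoc X z) <->
        z = expmx (t h *: (Q *m M)) *m X i0
            + t h *: (phimx (t h *: (Q *m M)) *m Q *m gradK_const U X)
            + t h *: (phimx (t h *: (Q *m M)) *m Q *m gradK_lin U X) *m z.
      rewrite stepE -/(t h) mulmxDr scalerDr -scalemxAl [X in _ + X]addrC addrA.
      by rewrite !mulmxA.
    by exists y; split=> [|z /stepE' /uy]; first exact/stepE'.
apply: growth_le_expR => [||n|n nT].
- by rewrite mulr_ge0.
- exact: ltW.
- exact: tuple_norm_ge0.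
have nT' : n%:R * h <= T.
  by rewrite (le_trans _ nT)// ler_wpM2r ?ltW// ltr_nat.
have Kx := xK n nT'; have Kxt := xtK n nT'.
pose e := tuple_norm N (window x k n \- window xt k n).
have e0 : 0 <= e by exact: tuple_norm_ge0.
apply: tuple_norm_window_succ; first by rewrite lerDl !mulr_ge0// ltW.
have := xS n nT; rewrite window_snoc => /stepE ey.
have := xtS n nT; rewrite window_snoc => /stepE eyt.
have -> : 1 + g * k%:R * h = 1 + t h * g by rewrite /t; ring.
apply: (linearly_implicit_perturbation hN (x := window x k n i0)
  (x' := window xt k n i0) th0 thc r0 beta0 _ _ _ _ _ _ _ _ _ _ ey eyt) => //.
- by move=> v; exact: hE.
- by move=> v; exact: hW.
- by move=> v; exact: hBX.
- move=> v; rewrite (le_trans (norm_le_opnorm hN _ _))// ler_wpM2r ?norm_ge0//.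
  by rewrite (le_trans (hLB _ _ Kx Kxt))// ler_wpM2r// ler_norm.
- by rewrite (le_trans (hLl _ _ Kx Kxt))// ler_wpM2r// ler_norm.
- exact: (@le_tuple_norm _ _ N _ (window x k n \- window xt k n) i0).
(* x~_(n+k) is the last entry of the next history, which also lies in K *)
have jk : (k.-1 < k)%N by rewrite prednK.
have := @le_tuple_norm _ _ N _ (window xt k n.+1) (Ordinal jk).
rewrite /window /= addSnnS prednK// => /le_trans; apply.
by rewrite (le_trans (hrK _ (xtK _ nT)))// ler_norm.
Qed.
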